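(* Let $X$ be a complete separable Riemannian manifold and $Y$ a Polish space, equipped with Borel probability measures $\mu$ on $X$ and $\nu$ on $Y$. Let $c : X \times Y \to \mathbb{R}$ be a bounded continuous cost function. Assume that: (1) $c$ satisfies the generalized-twist condition; (2) $\mu$ is non-atomic and any $c$-concave function is differentiable $\mu$-almost surely on its domain. Then for each optimal plan $\gamma$ of the Kantorovich problem $\inf\{\int_{X\times Y} c\,d\pi : \pi\in\Pi(\mu,\nu)\}$, there exist $k\in\mathbb{N}\cup\{\infty\}$, a (possibly infinite) sequence $\{\alpha_i\}_{i=1}^k$ of non-negative measurable real functions on $X$, and a sequence $\{G_i\}_{i=1}^k$ of Borel measurable maps from $X$ to $Y$ such that $$\gamma=\sum_{i=1}^k \alpha_i\,(\mathrm{Id}\times G_i)_\#\mu,$$ where $\sum_{i=1}^k\alpha_i(x)=1$ for $\mu$-almost every $x\in X$.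
   Context: $\Pi(\mu,\nu)$ is the set of Borel probability measures on $X\times Y$ with marginals $\mu$ and $\nu$. An optimal plan is a $\gamma\in\Pi(\mu,\nu)$ attaining $\inf\{\int_{X\times Y} c\,d\pi : \pi\in\Pi(\mu,\nu)\}$. Generalized-twist condition: $x\mapsto c(x,y)$ is differentiable for all $y\in Y$, and for any $x_0\in X$, $y_0\in Y$ the set $\{y\in Y : \frac{\partial c(x_0,y)}{\partial x}=\frac{\partial c(x_0,y_0)}{\partial x}\}$ is finite. A function $\varphi:X\to\mathbb{R}\cup\{-\infty\}$, not identically $-\infty$, is $c$-concave if $\varphi(x)=\inf_{y\in Y}[c(x,y)-\psi(y)]$ for some $\psi:Y\to\mathbb{R}\cup\{\pm\infty\}$; its domain is the set where it is finite. The notation $\gamma=\sum_{i=1}^k \alpha_i(\mathrm{Id}\times G_i)_\#\mu$ means that $\gamma(S)=\sum_{i=1}^k\int_X\alpha_i(x)\chi_S(x,G_i(x))\,d\mu(x)$ for every measurable $S\subset X\times Y$, where $\chi_S$ is the indicator function of $S$. When $k=\infty$ the index $i$ runs over all of $\mathbb{N}=\{1,2,\dots\}$. *)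

(* Defs.v *)
From HB Require Import structures.
From mathcomp Require Import all_boot all_order all_algebra.
From mathcomp Require Import all_classical all_reals all_analysis.

Set Implicit Arguments.
Unset Strict Implicit.
Unset Printing Implicit Defensive.

Import Order.TTheory GRing.Theory Num.Theory.
Import numFieldNormedType.Exports.

Local Open Scope classical_set_scope.
Local Open Scope ring_scope.

(* Carriers are pointed because [g_sigma_algebraType] requires it; a space
   carrying a probability measure is nonempty anyway. *)
Notation borel T := (g_sigma_algebraType (@open T)).

Definition separable_space (T : topologicalType) : Prop :=
  exists2 D : set T, countable D & dense D.

(* Distances are extended-real valued: the Riemannian distance between two
   connected components is +oo. *)
Definition complete_dist (R : realType) (T : Type) (d : T -> T -> \bar R) :
    Prop :=
  forall u : nat -> T,
    (forall e : R, 0 < e -> exists N : nat, forall p q : nat,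
      (N <= p)%N -> (N <= q)%N -> (d (u p) (u q) < e%:E)%E) ->
    exists l : T, forall e : R, 0 < e -> exists N : nat, forall p : nat,
      (N <= p)%N -> (d (u p) l < e%:E)%E.

Definition is_metric (R : realType) (T : Type) (d : T -> T -> R) : Prop :=
  [/\ forall x y, 0 <= d x y,
      forall x y, d x y = 0 <-> x = y,
      forall x y, d x y = d y x &
      forall x y z, d x z <= d x y + d y z].

Definition induces_topology (R : realType) (T : topologicalType)
    (d : T -> T -> R) : Prop :=
  forall (x : T) (A : set T),
    nbhs x A <-> exists2 e : R, 0 < e & [set y | d x y < e] `<=` A.

Definition polish_space (R : realType) (T : topologicalType) : Prop :=
  separable_space T /\
  exists d : T -> T -> R,
    [/\ is_metric d, induces_topology d &
        complete_dist (fun x y => (d x y)%:E)].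

(* Class C^k on an open set U; the values of f outside U are irrelevant. *)
Fixpoint Ck (R : realType) (V W : normedModType R) (k : nat) (U : set V)
    (f : V -> W) : Prop :=
  match k with
  | 0 => forall x, U x -> {for x, continuous f}
  | k'.+1 => (forall x, U x -> differentiable f x) /\
             forall v, Ck k' U (fun x => 'D_v f x)
  end.

Definition smooth_on (R : realType) (V W : normedModType R) (U : set V)
    (f : V -> W) : Prop :=
  forall k, Ck k U f.

(* A smooth n-manifold given by an atlas, with a Riemannian metric given by its
   Gram matrices in the charts. [rm_param i] inverts the chart [rm_coord i] on
   its image and is arbitrary elsewhere. [rm_chart_at] selects a chart around
   each point; the notions below do not depend on this selection. The Jacobian
   acts on row vectors from the right, hence the form of
   [rm_metric_transition]. *)
Record riemannianManifold (R : realType) (n : nat) (X : topologicalType) :=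
  RiemannianManifold {
  rm_hausdorff : hausdorff_space X;
  rm_second_countable : @second_countable X;
  rm_chart : Type;
  rm_dom : rm_chart -> set X;
  rm_coord : rm_chart -> X -> 'rV[R]_n;
  rm_param : rm_chart -> 'rV[R]_n -> X;
  rm_chart_at : X -> rm_chart;
  rm_dom_chart_at : forall x, rm_dom (rm_chart_at x) x;
  rm_dom_open : forall i, open (rm_dom i);
  rm_image_open : forall i, open (rm_coord i @` rm_dom i);
  rm_coordK : forall i x, rm_dom i x -> rm_param i (rm_coord i x) = x;
  rm_coord_continuous : forall i x,
    rm_dom i x -> {for x, continuous (rm_coord i)};
  rm_param_continuous : forall i u,
    (rm_coord i @` rm_dom i) u -> {for u, continuous (rm_param i)};
  rm_transition_smooth : forall i j,
    smooth_on (rm_coord i @` (rm_dom i `&` rm_dom j))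
      (rm_coord j \o rm_param i);
  rm_metric : rm_chart -> 'rV[R]_n -> 'M[R]_n;
  rm_metric_smooth : forall i,
    smooth_on (rm_coord i @` rm_dom i) (rm_metric i);
  rm_metric_sym : forall i u, (rm_coord i @` rm_dom i) u ->
    (rm_metric i u)^T = rm_metric i u;
  rm_metric_pos : forall i u, (rm_coord i @` rm_dom i) u ->
    forall v : 'rV[R]_n, v != 0 -> 0 < (v *m rm_metric i u *m v^T) 0 0;
  rm_metric_transition : forall i j x, rm_dom i x -> rm_dom j x ->
    let J := jacobian (rm_coord j \o rm_param i) (rm_coord i x) in
    rm_metric i (rm_coord i x) = J *m rm_metric j (rm_coord j x) *m J^T
}.

Arguments rm_dom {R n X} r _ _.
Arguments rm_coord {R n X} r _ _.
Arguments rm_param {R n X} r _ _.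
Arguments rm_metric {R n X} r _ _.

Section Manifold.
Context (R : realType) (n : nat) (X : topologicalType)
  (M : riemannianManifold R n X).

Definition local_coord (x : X) : X -> 'rV[R]_n := rm_coord M (rm_chart_at M x).

Definition local_repr (f : X -> R) (x : X) : 'rV[R]_n -> R :=
  f \o rm_param M (rm_chart_at M x).

Definition mdifferentiable (f : X -> R) (x : X) : Prop :=
  differentiable (local_repr f x) (local_coord x x).

(* The differential at x as a covector, the tangent space at x being
   identified with R^n through the selected chart at x. *)
Definition mdiff (f : X -> R) (x : X) : 'rV[R]_n -> R :=
  'd (local_repr f x) (local_coord x x).

Definition C1_curve (s : R -> X) : Prop :=
  continuous s /\
  forall i, Ck 1 (s @^-1` rm_dom M i) (rm_coord M i \o s).

Definition velocity (s : R -> X) (t : R) : 'rV[R]_n :=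
  derive1 (local_coord (s t) \o s) t.

Definition speed (s : R -> X) (t : R) : R :=
  let v := velocity s t in
  Num.sqrt ((v *m rm_metric M (rm_chart_at M (s t)) (local_coord (s t) (s t))
               *m v^T) 0 0).

Definition curve_length (s : R -> X) : \bar R :=
  (\int[lebesgue_measure]_(t in `[0%R, 1%R]) (speed s t)%:E)%E.

(* A piecewise C^1 path is the concatenation of finitely many C^1 arcs, each
   the restriction to [0, 1] of a C^1 curve defined on R. *)
Fixpoint piecewise_C1_path (x : X) (p : seq (R -> X)) (y : X) : Prop :=
  match p with
  | [::] => x = y
  | s :: p' => [/\ C1_curve s, s 0 = x & piecewise_C1_path (s 1) p' y]
  end.

Definition path_length (p : seq (R -> X)) : \bar R :=
  (\sum_(s <- p) curve_length s)%E.

Definition riemannian_dist (x y : X) : \bar R :=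
  ereal_inf [set path_length p | p in [set p | piecewise_C1_path x p y]].

End Manifold.

Definition nonatomic d (T : measurableType d) (R : realType)
    (mu : {measure set T -> \bar R}) : Prop :=
  forall A : set T, measurable A -> (0 < mu A)%E ->
    exists B : set T, [/\ measurable B, B `<=` A & (0 < mu B < mu A)%E].

Section Transport.
Context (R : realType) (X Y : ptopologicalType).
Implicit Types (c : X * Y -> R) (mu : probability (borel X) R)
  (nu : probability (borel Y) R) (pi : probability (borel (X * Y)%type) R).

Definition coupling mu nu pi : Prop :=
  (forall A : set (borel X), measurable A -> pi (fst @^-1` A) = mu A) /\
  (forall B : set (borel Y), measurable B -> pi (snd @^-1` B) = nu B).

Definition transport_cost c pi : \bar R := (\int[pi]_z (c z)%:E)%E.

Definition optimal_plan c mu nu pi : Prop :=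
  coupling mu nu pi /\
  transport_cost c pi =
    ereal_inf [set transport_cost c pi' | pi' in [set pi' | coupling mu nu pi']].

Definition c_concave c (phi : X -> \bar R) : Prop :=
  [/\ forall x, phi x <> +oo%E,
      exists x, phi x <> -oo%E &
      exists psi : Y -> \bar R, forall x,
        phi x = ereal_inf [set ((c (x, y))%:E - psi y)%E | y in [set: Y]]].

Definition generalized_twist (n : nat) (M : riemannianManifold R n X) c :
    Prop :=
  (forall y x, mdifferentiable M (fun x' => c (x', y)) x) /\
  forall (x0 : X) (y0 : Y),
    finite_set [set y : Y | mdiff M (fun x => c (x, y)) x0 =
                            mdiff M (fun x => c (x, y0)) x0].

(* Differentiability at a point requires finiteness near that point. *)
Definition emdifferentiable (n : nat) (M : riemannianManifold R n X)
    (phi : X -> \bar R) (x : X) : Prop :=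
  (\forall z \near x, phi z \is a fin_num) /\
  mdifferentiable M (fine \o phi) x.

End Transport.

(* k : option nat encodes an element of N u {oo}, None being oo; the indices
   1, 2, ... are shifted to 0, 1, ... *)
Definition index_lt (i : nat) (k : option nat) : bool :=
  if k is Some m then (i < m)%N else true.

(* Main.v *)
(** The support [S] of an optimal plan is [c]-cyclically monotone: mass near a
    finite family of points of [S] could otherwise be rearranged at lower cost,
    replacing the conditional measures of the plan on small boxes by products of
    their marginals. Rockafellar's chain construction then gives a [c]-concave
    [phi] such that [c (_, y) - phi] is minimal at [x] for all [(x, y)] in [S].
    Where [phi] is differentiable, all the points of the section [S_x] thus have
    the same [d_x c (x, y) = d phi (x)], so that [S_x] is finite for [mu]-almost
    every [x].

    To cover [S] by countably many Borel graphs, restrict [y] to compact sets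
    (given by tightness of [nu]) and intersect with the members of a countable
    base of closed neighbourhoods of [Y]: any point of a finite section is
    isolated by one of them, and the selection defined where the restricted
    section is a singleton is Borel because projections along a compact factor
    are closed. The weights [alpha i] are the Radon-Nikodym densities of the
    first marginals of the plan restricted to the disjointified graphs. *)
Require Import Defs.
From mathcomp Require Import all_boot all_order all_algebra.
From mathcomp Require Import all_classical all_reals all_analysis.
From mathcomp Require Import measurable_realfun ring lra.

Set Implicit Arguments.
Unset Strict Implicit.
Unset Printing Implicit Defensive.

Import Order.TTheory GRing.Theory Num.Theory.
Import numFieldNormedType.Exports.

Local Open Scope classical_set_scope.
Local Open Scope ring_scope.

(** * Metric topology *)

(** The members need not be open. Open sets serve on [X]; closed sets serve on [Y], where they get
    intersected with compact sets. *)
Definition nbhs_base (T : topologicalType) (F : nat -> set T) : Prop :=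
  forall (x : T) A, nbhs x A -> exists2 j, nbhs x (F j) & F j `<=` A.

Lemma countable_range (T : Type) (D : set T) :
  countable D -> D !=set0 -> exists q : nat -> T, range q = D.
Proof.
move=> /pfcard_geP[->|[f]] [x Dx]; first by case: Dx.
exists f; apply/seteqP; split=> [_ [i _ <-]|y /(@surj _ _ _ _ f)[i _ <-]].
  exact: (@funS _ _ _ _ f).
by exists i.
Qed.

Lemma second_countable_base (T : ptopologicalType) :
  @second_countable T -> exists2 U : nat -> set T,
    forall j, open (U j) & nbhs_base U.
Proof.
move=> [B cB [Bo Bb]].
have [|U UB] := countable_range cB.
  by have [V [? ?] ?] := Bb point setT filterT; exists V.
exists U => [j|x A /Bb[V [BV Vx] VA]].
  by apply: Bo; rewrite -UB; exists j.
move: BV; rewrite -UB => -[j _ Uj]; exists j; rewrite Uj//.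
by apply: open_nbhs_nbhs; split=> //; apply: Bo; rewrite -UB; exists j.
Qed.

Section metric_topology.
Context (R : realType) (T : ptopologicalType) (d : T -> T -> R).
Hypotheses (dm : is_metric d) (dtop : induces_topology d).

Let d_ge0 x y : 0 <= d x y. Proof. by case: dm. Qed.
Let d_eq0 x y : d x y = 0 -> x = y. Proof. by case: dm => _ /(_ x y)[]. Qed.
Let dxx x : d x x = 0. Proof. by case: dm => _ /(_ x x)[_ ->]. Qed.
Let dC x y : d x y = d y x. Proof. by case: dm. Qed.
Let d_tri x y z : d x z <= d x y + d y z. Proof. by case: dm. Qed.

Definition cball (x : T) (e : R) : set T := [set y | d x y <= e].

Lemma closed_cball x e : closed (cball x e).
Proof.
rewrite -[cball x e]setCK; apply: open_closedC; rewrite openE => y /= /negP.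
rewrite -ltNge => exy; apply/(dtop y); exists (d x y - e);
  first by rewrite subr_gt0.
move=> z /=; rewrite ltrBrDl => H /=; apply/negP; rewrite -ltNge.
have := d_tri x z y; rewrite (dC z y); lra.
Qed.

Lemma nbhs_cball x y e : d x y < e -> nbhs y (cball x e).
Proof.
move=> H; apply/(dtop y); exists (e - d x y); first by rewrite subr_gt0.
by move=> z /=; rewrite /cball/=; have := d_tri x y z; lra.
Qed.

Lemma metric_hausdorff : hausdorff_space T.
Proof.
move=> p q; apply: contraPP => /eqP pq.
move=> /(_ (cball p (d p q / 3)) (cball q (d p q / 3))).
have dp : 0 < d p q.
  by rewrite lt0r d_ge0 andbT; apply: contra_neq pq => /d_eq0.
case.
- by apply: nbhs_cball; rewrite dxx; lra.
- by apply: nbhs_cball; rewrite dxx; lra.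
- by move=> z [] /=; rewrite /cball/= => H1 H2; have := d_tri p z q;
  rewrite (dC z q); lra.
Qed.

Lemma dense_metric (D : set T) : dense D ->
  forall x e, 0 < e -> exists2 q, D q & d q x < e.
Proof.
move=> dD x e e0.
have [q [/interior_subset qx Dq]] : ([set y | d x y < e]° `&` D) !=set0.
  apply: dD; last exact: open_interior.
  by exists x; apply/(dtop x); exists e.
by exists q => //; rewrite dC.
Qed.

Lemma separable_metric_base : separable_space T ->
  exists2 F : nat -> set T, forall j, closed (F j) & nbhs_base F.
Proof.
move=> [D cD dD].
have [|q qD] := countable_range cD.
  by have [y Dy _] := dense_metric dD point ltr01; exists y.
(* Codes that decode to no pair give the whole space, which is closed. *)
pose F j := if @unpickle (nat * nat)%type j is Some (a, k) then
  cball (q a) k.+1%:R^-1 else setT.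
exists F => [j|x A /(dtop x)[e e0 eA]].
  rewrite /F; case: unpickle => [[a k]|]; [exact: closed_cball|exact: closedT].
(* The ball is centred at a point [q a] near [x], not at [x], so its points are only within twice
   its radius of [x]; hence [e / 2]. *)
have [k ke] : exists k : nat, k.+1%:R^-1 < e / 2.
  by exists (Num.truncn (e / 2)^-1);
    rewrite invf_plt ?posrE ?divr_gt0// truncnS_gt.
have := @dense_metric _ dD x k.+1%:R^-1; case; first by rewrite invr_gt0.
rewrite -qD => _ [a _ <-] qax.
exists (pickle (a, k)); rewrite /F pickleK.
  exact: nbhs_cball.
by move=> y; rewrite /cball/= => H; apply: eA => /=; have := d_tri x (q a) y;
  rewrite (dC x (q a)); move: k.+1%:R^-1 ke qax H => r; lra.
Qed.

(** By the finite covers, an ultrafilter containing [C] contains a ball of each radius. Points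
    chosen in the intersections of the first balls form a Cauchy sequence, whose limit is a limit of
    the ultrafilter. *)
Lemma complete_totally_bounded_compact (C : set T) :
  complete_dist (fun x y => (d x y)%:E) -> closed C ->
  (forall k : nat, exists s : seq T,
    C `<=` \bigcup_(x in [set` s]) cball x k.+1%:R^-1) ->
  compact C.
Proof.
move=> dcomp Ccl /choice[s Cs]; rewrite compact_ultra => F FU FC.
have FB k : exists x, F (cball x k.+1%:R^-1).
  have : F (\bigcup_(x in [set` s k]) cball x k.+1%:R^-1).
    exact: filterS FC.
  rewrite bigcup_seq.
  elim: (s k) => [|x r IH].
    rewrite big_nil => /filter_ex[? []].
  rewrite big_cons => FU'.
  have [?|FN] := in_ultra_setVsetC (cball x k.+1%:R^-1) FU; first by exists x.
  by apply: IH; apply: filterS2 FU' FN => y [].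
move: FB => /choice[x Fx].
have /choice[u Hu] (m : nat) : exists u, forall k, (k <= m)%N ->
  cball (x k) k.+1%:R^-1 u.
  have : F [set u | forall k, (k <= m)%N -> cball (x k) k.+1%:R^-1 u].
    elim: m => [|m IH].
      by apply: filterS (Fx 0%N) => y ? k; rewrite leqn0 => /eqP ->.
    apply: filterS2 IH (Fx m.+1) => y H1 H2 k.
    by rewrite leq_eqVlt => /predU1P[->//|]; rewrite ltnS; exact: H1.
  by move=> /filter_ex.
have small (e : R) : 0 < e -> exists k : nat, k.+1%:R^-1 < e.
  move=> e0; exists (Num.truncn e^-1); by rewrite invf_plt ?posrE// truncnS_gt.
have [l Hl] : exists l : T, forall e : R, 0 < e ->
  exists N : nat, forall p : nat,
      (N <= p)%N -> (d (u p) l < e).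
  have [e e0|l Hl] := dcomp u.
    have [|N HN] := small (e / 2); first by rewrite divr_gt0.
    exists N => p q /Hu + /Hu; rewrite /cball/= lte_fin => H1 H2.
    by have := d_tri (u p) (x N) (u q); rewrite (dC _ (x N));
      move: N.+1%:R^-1 HN H1 H2 => r; lra.
  by exists l => e /Hl[N HN]; exists N => p /HN; rewrite lte_fin.
have Fl : F --> l.
  move=> A /(dtop l)[e e0 eA].
  have [|N HN] := small (e / 3); first by rewrite divr_gt0.
  have [|N' HN'] := Hl (e / 3); first by rewrite divr_gt0.
  apply: filterS (Fx N) => y; rewrite /cball/= => Hy; apply: eA => /=.
  have := HN' (maxn N N') (leq_maxr _ _).
  have := Hu (maxn N N') N (leq_maxl _ _); rewrite /cball/=.
  set p := maxn _ _ => H1 H2.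
  have := d_tri l (u p) y; have := d_tri (u p) (x N) y.
  rewrite (dC l (u p)) (dC (u p) (x N)); move: N.+1%:R^-1 HN Hy H1 => r; lra.
exists l; split=> //.
by apply: Ccl => B /Fl FB; exact: filter_ex (filterI FC FB).
Qed.

End metric_topology.

(** * Borel sets of products and tightness *)

Section generated_sigma_algebra.
Context {T : pointedType} {G : set (set T)}.

Lemma measurable_gen (A : set T) :
  G A -> measurable (A : set (g_sigma_algebraType G)).
Proof. by move=> GA; exact: sub_sigma_algebra. Qed.

Lemma measurable_genC (A : set T) :
  G (~` A) -> measurable (A : set (g_sigma_algebraType G)).
Proof. by move=> GA; rewrite -[A]setCK; apply: measurableC;
  exact: measurable_gen. Qed.

Lemma measurable_fun_gen d (S : measurableType d) (f : S ->
  g_sigma_algebraType G) :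
  (forall A, G A -> measurable (f @^-1` A)) -> measurable_fun setT f.
Proof.
move=> fG; apply: (@measurability _ _ _ (g_sigma_algebraType G) setT f G erefl).
by move=> _ [A GA <-]; rewrite setTI; exact: fG.
Qed.

Lemma measurable_fun_genR (R : realType) (f : T -> R) :
  (forall A, open A -> G (f @^-1` A)) ->
  measurable_fun setT (f : g_sigma_algebraType G -> R).
Proof.
move=> fG; apply: (measurability _ (RGenOpens.measurableE R)).
move=> _ [_ [a [b ->]] <-]; rewrite setTI; apply: measurable_gen.
by apply: fG; exact: interval_open.
Qed.

End generated_sigma_algebra.

Section borel_prod.
Context {X Y : ptopologicalType}.

Lemma open_prod_bigcup (U : nat -> set X) (V : nat -> set Y) (O : set (X * Y)) :
  nbhs_base U -> nbhs_base V -> open O ->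
  O = \bigcup_i \bigcup_(j in [set j | U i `*` V j `<=` O]) (U i `*` V j).
Proof.
move=> Ub Vb oO; apply/seteqP; split=> [[x y] Oxy|z [i _ [j UVO Hz]]];
  last exact: UVO.
have : nbhs (x, y) O by exact: open_nbhs_nbhs.
move=> [[A B] /= [/Ub[i Ui UA] /Vb[j Vj VB]] ABO].
exists i => //; exists j => /=.
  by move=> z [/UA ? /VB ?]; exact: ABO.
by split; exact: nbhs_singleton.
Qed.

(** Every open set of the product is a countable union of measurable boxes, so it suffices that both
    components are measurable. *)
Lemma measurable_fun_borel_pair d (T : measurableType d) (U : nat -> set X)
    (V : nat -> set Y) (f : T -> X) (g : T -> Y) :
  (forall i, measurable (U i : set (borel X))) ->
  (forall j, measurable (V j : set (borel Y))) ->
  nbhs_base U -> nbhs_base V ->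
  measurable_fun setT (f : T -> borel X) -> measurable_fun setT (g : T ->
    borel Y) ->
  measurable_fun setT ((fun t => (f t, g t)) : T -> borel (X * Y)%type).
Proof.
move=> mU mV Ub Vb mf mg.
apply: measurable_fun_gen => O oO.
rewrite (open_prod_bigcup Ub Vb oO) preimage_bigcup.
apply: bigcup_measurable => i _; rewrite preimage_bigcup.
apply: bigcup_measurable => j _.
have -> : (fun t => (f t, g t)) @^-1` (U i `*` V j) = (f @^-1` U i) `&` (g
  @^-1` V j) by [].
by apply: measurableI; rewrite -[X in measurable X]setTI; [exact: mf|exact: mg].
Qed.

Lemma measurable_fst_borel : measurable_fun setT (fst :
  borel (X * Y)%type -> borel X).
Proof.
apply: measurable_fun_gen => A oA; apply: measurable_gen.
by apply: open_comp => // z _; exact: cvg_fst.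
Qed.

Lemma measurable_snd_borel : measurable_fun setT (snd :
  borel (X * Y)%type -> borel Y).
Proof.
apply: measurable_fun_gen => A oA; apply: measurable_gen.
by apply: open_comp => // z _; exact: cvg_snd.
Qed.

(** Tube lemma: if the fibre of [S] over [x] misses [C], compactness gives one neighbourhood of [x]
    over which all fibres miss [C]. *)
Lemma closed_fst_compact (S : set (X * Y)) (C : set Y) :
  closed S -> compact C -> closed (fst @` (S `&` snd @^-1` C)).
Proof.
move=> Scl /compact_near_coveringP Cc.
rewrite -[fst @` _]setCK; apply: open_closedC; rewrite openE => x /= xN.
have : \forall x' \near x, C `<=` (fun y => ~ S (x', y)).
  apply: Cc => y Cy.
  have : nbhs (x, y) (~` S).
    apply: open_nbhs_nbhs; split; first exact: closed_openC.
    by move=> Sxy; apply: xN; exists (x, y).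
  move=> [[A B] /= [xA yB] AB]; exists (B, A) => // -[y' x'] /= [? ?].
  exact: (AB (x', y')).
by apply: filterS => x' CS [[x0 y] [/= Sxy Cy] /= xx']; apply: (CS y Cy);
  rewrite -xx'.
Qed.

End borel_prod.

(** Ulam's theorem. For each radius, finitely many balls centred in a dense sequence carry almost
    all the mass; intersecting over the radii gives a closed totally bounded set [C m], whose
    complement has mass at most [m.+1%:R^-1]. *)
Lemma polish_tight (R : realType) (Y : ptopologicalType) (nu :
  probability (borel Y) R) :
  polish_space R Y ->
  exists2 C : nat -> set Y, forall m, compact (C m) /\ closed (C m) &
    nu (~` \bigcup_m C m) = 0%E.
Proof.
move=> [[D cD dD] [d [dm dtop dcomp]]].
have [|q qD] := countable_range cD.
  by have [y Dy _] := dense_metric dm dtop dD point ltr01; exists y.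
pose B k N := \bigcup_(j in `I_N) cball d (q j) k.+1%:R^-1.
have Bcl k N : closed (B k N).
  by apply: closed_bigcup => [|j _]; [exact: finite_II|exact: closed_cball].
have mB k N : measurable (~` B k N : set (borel Y)).
  by apply: measurableC; apply: measurable_genC; exact: closed_openC.
have Bcap k : \bigcap_N ~` B k N = set0.
  rewrite -setC_bigcup (_ : \bigcup_N _ = setT) ?setCT//.
  apply/seteqP; split=> // y _.
  have [|z] := @dense_metric _ _ _ dm dtop _ dD y k.+1%:R^-1;
    first by rewrite invr_gt0.
  by rewrite -qD => -[a _ <-] /ltW ?; exists a.+1 => //; exists a => /=.
have small m k : exists N, (nu (~` B k N) < ((m.+1%:R^-1 :
  R) / (2 ^ k.+1)%:R)%:E)%E.
  have cv : nu (~` B k N) @[N --> \oo] --> 0%E.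
    rewrite -(measure0 nu) -(Bcap k); apply: nonincreasing_cvg_mu => //.
    - by rewrite (le_lt_trans (probability_le1 _ _))// ltry.
    - by rewrite Bcap.
    - move=> N N' NN'; apply/subsetPset; apply: subsetC => y [j /= jN ?].
      by exists j => //=; exact: leq_trans NN'.
  have e0 : 0 < (m.+1%:R^-1 : R) / (2 ^ k.+1)%:R.
    by rewrite divr_gt0 ?invr_gt0// ltr0n expn_gt0.
  have : \forall N \near \oo, (nu (~` B k N) < ((m.+1%:R^-1 :
    R) / (2 ^ k.+1)%:R)%:E)%E.
    have := open_ereal_lt' (_ : 0 < ((m.+1%:R^-1 : R) / (2 ^ k.+1)%:R)%:E)%E.
    by rewrite lte_fin => /(_ e0); exact: cv.
  by move=> /filter_ex.
have /choice[N HN] m : exists N, forall k,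
    (nu (~` B k (N k)) < ((m.+1%:R^-1 : R) / (2 ^ k.+1)%:R)%:E)%E.
  by have /choice[N HN] := small m; exists N.
pose C m := \bigcap_k B k (N m k).
have Ccl m : closed (C m) by apply: closed_bigI.
have mC m : measurable (C m : set (borel Y)).
  by apply: measurable_genC; exact: closed_openC.
have nuC m : (nu (~` C m) <= (m.+1%:R^-1)%:E)%E.
  apply: (@le_trans _ _ (\sum_(0 <= k <oo) nu (~` B k (N m k)))%E).
    apply: measure_sigma_subadditive => //; first exact: measurableC.
    by rewrite /C setC_bigcap.
  (* The losses at the successive radii are bounded by a geometric series. *)
  apply: le_trans (epsilon_trick0 xpredT _); last by rewrite invr_ge0.
  by apply: lee_nneseries => // k _; exact: ltW.
exists C => [m|].
  split=> //; apply: (complete_totally_bounded_compact dm dtop dcomp) => // k.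
  exists [seq q j | j <- iota 0 (N m k)] => y /(_ k I)[j /= jN ?].
  by exists (q j) => //=; apply/mapP; exists j => //; rewrite mem_iota.
apply/eqP; rewrite -measure_le0; apply/lee_addgt0Pr => e e0; rewrite add0e.
have [m me] : exists m : nat, m.+1%:R^-1 < e.
  by exists (Num.truncn e^-1); rewrite invf_plt ?posrE// truncnS_gt.
apply: (@le_trans _ _ (nu (~` C m))).
  apply: le_measure; rewrite ?inE.
  - by apply: measurableC; exact: bigcup_measurable.
  - exact: measurableC.
  - by apply: subsetC => y Cy; exists m.
by apply: (le_trans (nuC m)); rewrite lee_fin ltW.
Qed.

(** * Borel covers of closed sets with finite sections *)

Section uniformization.
Context (X Y : ptopologicalType) (F : nat -> set Y).
Hypotheses (hY : hausdorff_space Y) (Fcl : forall j, closed (F j))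
  (Fb : nbhs_base F).

(* Selecting only where the section is a singleton makes the preimage of [F i]
   the projection of a closed set with compact fibres, hence closed. *)
Lemma measurable_unique_selection (S : set (X * Y)) (C : set Y) :
  closed S -> compact C ->
  exists2 g : X -> Y, measurable_fun setT (g : borel X -> borel Y) &
    forall x y, S (x, y) -> C y ->
      (forall y', S (x, y') -> C y' -> y' = y) -> g x = y.
Proof.
move=> Scl Cc.
pose E A := fst @` (S `&` snd @^-1` (C `&` A)).
have mE A : closed A -> measurable (E A : set (borel X)).
  move=> Acl; apply: measurable_genC; apply: closed_openC.
  by apply: closed_fst_compact => //; exact: compact_closedI.
have EP A x : E A x <-> exists y, [/\ S (x, y), C y & A y].
  split=> [[[x' y] [/= ? [? ?]] <-]|[y [? ? ?]]]; first by exists y.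
  by exists (x, y).
(* Two distinct points of a section lie in disjoint members of [F], [Y] being Hausdorff. So [D] is
   the set where the section restricted to [C] is a singleton, expressed through countably many
   projections. *)
pose D := E setT `\`
  \bigcup_i \bigcup_(l in [set l | F i `&` F l = set0]) (E (F i) `&` E (F l)).
have mD : measurable (D : set (borel X)).
  apply: measurableD; first exact: mE closedT.
  apply: bigcup_measurable => i _; apply: bigcup_measurable => l _.
  by apply: measurableI; exact: mE.
have Duniq x y y' : D x -> S (x, y) -> C y -> S (x, y') -> C y' -> y = y'.
  move=> [_ DN] Sy Cy Sy' Cy'; apply: contrapT => /eqP yy'.
  move: hY; rewrite open_hausdorff => /(_ _ _ yy')[[A B] /= [+ + [oA oB AB]]].
  rewrite !inE => Ay By'.
  have [i yi iA] := Fb (open_nbhs_nbhs (conj oA Ay)).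
  have [l yl lB] := Fb (open_nbhs_nbhs (conj oB By')).
  apply: DN; exists i => //; exists l => /=.
    by apply/seteqP; split=> // z [/iA Az /lB Bz]; rewrite -(eqP AB).
  by split; apply/EP; [exists y|exists y']; split => //; exact: nbhs_singleton.
pose g x := xget point [set y | [/\ D x, S (x, y) & C y]].
have gN x : ~ D x -> g x = point.
  by move=> Dx; apply: xgetPN => y [].
have gD x : D x -> S (x, g x) /\ C (g x).
  move=> Dx; have [[[x' y] [/= Sxy [Cy _]] xx'] _] := Dx; rewrite {}xx' in Sxy.
  have : [set y | [/\ D x, S (x, y) & C y]] y by [].
  by move=> /(xgetI point)[].
exists g.
  apply: measurable_fun_gen => O oO.
  (* On [D] the restricted section is reduced to [g x], so it meets [F i] exactly when [g x] is in
     [F i]; off [D], [g] is constantly [point]. *)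
  have -> : g @^-1` O = (D `&` \bigcup_(i in [set i | F i `<=` O]) E (F i))
      `|` (~` D `&` [set x | O point]).
    apply/seteqP; split=> [x /= Ogx|
      x [[Dx [i /= iO /EP[y [Sy Cy Fy]]]]|[Dx /= Op]]].
    - have [Dx|Dx] := pselect (D x); last by right; split=> //=;
      rewrite -(gN x).
      left; split => //; have [Sg Cg] := gD _ Dx.
      have [i gi iO] := Fb (open_nbhs_nbhs (conj oO Ogx)).
      by exists i => //; apply/EP; exists (g x); split=> //;
        exact: nbhs_singleton.
    - have [Sg Cg] := gD _ Dx.
      by rewrite /= (Duniq x (g x) y)//; exact: iO.
    - by rewrite /= gN.
  apply: measurableU; apply: measurableI => //.
  - by apply: bigcup_measurable => i _; exact: mE.
  - exact: measurableC.
  - have [Op|Op] := pselect (O point).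
      by rewrite (_ : [set _ | _] = setT)//; apply/seteqP; split.
    by rewrite (_ : [set _ | _] = set0)//; apply/seteqP; split.
move=> x y Sy Cy yu.
have Dx : D x.
  split; first by apply/EP; exists y.
  move=> [i _ [l /= il [/EP[a [Sa Ca Fa]] /EP[b [Sb Cb Fb']]]]].
  rewrite (yu _ Sa Ca) in Fa; rewrite (yu _ Sb Cb) in Fb'.
  by have : (F i `&` F l) y by []; rewrite il.
by have [Sg Cg] := gD _ Dx; exact: yu.
Qed.

(** There is one selection for each pair [(m, j)]. A point of a finite section is separated from the
    others by some [F j] and lies in some [C m], so the selection for that pair picks it. *)
Lemma measurable_graph_cover (S : set (X * Y)) (C : nat -> set Y) :
  closed S -> (forall m, compact (C m)) ->
  exists2 G : nat -> X -> Y, forall i, measurable_fun setT (G i : borel X ->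
    borel Y) &
    forall x y, S (x, y) -> (\bigcup_m C m) y ->
      finite_set [set y | S (x, y)] ->
      exists i, G i x = y.
Proof.
move=> Scl Cc.
have /choice[g gP] (mj : nat * nat) : exists g : X -> Y,
    measurable_fun setT (g : borel X -> borel Y) /\
    forall x y, S (x, y) -> (C mj.1 `&` F mj.2) y ->
      (forall y', S (x, y') -> (C mj.1 `&` F mj.2) y' -> y' = y) -> g x = y.
  have [g ? ?] := @measurable_unique_selection S (C mj.1 `&` F mj.2) Scl
    (compact_closedI (Cc mj.1) (@Fcl mj.2)).
  by exists g.
exists (fun i => g (odflt (0%N, 0%N) (unpickle i))) => [i|x y Sxy [m _ Cy] fS].
  by have [] := gP (odflt (0%N, 0%N) (unpickle i)).
have fS' : finite_set ([set y | S (x, y)] `\ y) by exact: finite_setD.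
have cS : closed ([set y | S (x, y)] `\ y).
  by move/hausdorff_accessible/accessible_finite_set_closed : hY; exact.
have [|j yj jS] := Fb (_ : nbhs y (~` ([set y | S (x, y)] `\ y))).
  by apply: open_nbhs_nbhs; split; [exact: closed_openC|case=> _; apply].
exists (pickle (m, j)); rewrite pickleK /=.
have [_ /(_ x y Sxy)] := gP (m, j); apply.
  by split=> //=; exact: nbhs_singleton.
move=> y' Sy' [_ /= /jS/= H]; apply: contrapT => yy'; exact: H.
Qed.

End uniformization.

(** * Decomposition along graphs *)

(** Radon-Nikodym theorem: the bound makes [m] finite and absolutely continuous. The density is
    finite and non-negative at every point, so passing to real values loses nothing. *)
Lemma dominated_density d (T : measurableType d) (R : realType)
    (mu : probability T R) (m : {measure set T -> \bar R}) :
  (forall A, measurable A -> (m A <= mu A)%E) ->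
  exists a : T -> R, [/\ measurable_fun setT a, forall x, 0 <= a x &
    forall A, measurable A -> m A = (\int[mu]_(x in A) (a x)%:E)%E].
Proof.
move=> mmu.
have moo : (m setT < +oo)%E.
  by rewrite (le_lt_trans (mmu _ measurableT))// probability_setT ltry.
pose m' : {finite_measure set T -> \bar R} := mfrestr measurableT moo.
have m'E A : m' A = m A by rewrite -[in RHS](setIT A).
have m'mu : m' `<< mu.
  apply/null_content_dominatesP => A mA muA.
  by have := mmu _ mA; rewrite muA -m'E measure_le0 => /eqP.
pose f := Radon_Nikodym_SigmaFinite.f m' mu.
have fE x : (fine (f x))%:E = f x.
  by rewrite fineK//; exact: Radon_Nikodym_SigmaFinite.f_fin_num.
exists (fine \o f); split.
- apply/measurable_EFinP; rewrite (_ : EFin \o _ = f); last exact/funext.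
  exact: measurable_int (Radon_Nikodym_SigmaFinite.f_integrable m'mu).
- by move=> x; apply: fine_ge0; exact: Radon_Nikodym_SigmaFinite.f_ge0.
- move=> A mA; under eq_integral do rewrite /= fE.
  by rewrite -m'E; exact: Radon_Nikodym_SigmaFinite.f_integral.
Qed.

Lemma measure_pushforward d1 d2 (T1 : measurableType d1)
    (T2 : measurableType d2) (R : realType) (m : {measure set T1 -> \bar R})
    (f : T1 -> T2) : measurable_fun setT f ->
  exists m' : {measure set T2 -> \bar R}, forall A, m' A = m (f @^-1` A).
Proof.
move=> mf.
by exists (measure_function_pushforward__canonical__measure_function_Measure m
  mf).
Qed.

Section graph_decomposition.
Context (R : realType) (X Y : ptopologicalType).
Context (mu : probability (borel X) R) (gamma :
  probability (borel (X * Y)%type) R).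
Hypothesis marg : forall A : set (borel X), measurable A ->
  gamma (fst @^-1` A) = mu A.
Context (G : nat -> X -> Y).
Hypothesis mpair : forall i, measurable_fun setT
  ((fun x => (x, G i x)) : borel X -> borel (X * Y)%type).
Hypothesis mgraph : forall i,
  measurable ([set z | G i z.1 = z.2] : set (borel (X * Y)%type)).
Hypothesis gamma_graphs : gamma (\bigcap_i [set z | G i z.1 <> z.2]) = 0%E.

(** [gamma] splits into its restrictions to the disjointified graphs. The first marginal of each
    piece is dominated by [mu], hence has a density, and a piece carried by a graph is determined by
    its first marginal. *)
Lemma graph_decomposition : exists alpha : nat -> X -> R,
  [/\ forall i, measurable_fun setT (alpha i : borel X -> R),
      forall i x, 0 <= alpha i x,
      forall S : set (borel (X * Y)%type), measurable S ->
        gamma S = (\sum_(0 <= i <oo) \int[mu]_x (alpha i x * \1_S (x,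
          G i x))%:E)%E &
      {ae mu, forall x, (\sum_(0 <= i <oo) (alpha i x)%:E)%E = 1%E}].
Proof.
pose H i : set (borel (X * Y)%type) :=
  seqDU (fun i => [set z : X * Y | G i z.1 = z.2]) i.
have mH i : measurable (H i).
  by apply: measurableD => //; apply: bigsetU_measurable => j _; exact: mgraph.
have HG i z : H i z -> G i z.1 = z.2 by case.
have gammaE S : measurable S -> gamma S = (\sum_(0 <= i <oo) gamma (S `&` H
  i))%E.
  move=> mS.
  have mU : measurable (\bigcup_i H i) by exact: bigcup_measurable.
  (* What lies outside all the [H i] lies on no graph. *)
  have U0 : gamma (S `\` \bigcup_i H i) = 0%E.
    apply/eqP; rewrite -measure_le0 -gamma_graphs; apply: le_measure.
    - by rewrite inE; exact: measurableD.
    - rewrite inE; apply: bigcap_measurable => // i _.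
      exact: (measurableC (mgraph i)).
    - by move=> z [_]; rewrite -seqDU_bigcup_eq => zN i _ Gz; apply: zN;
      exists i.
  have UE : gamma (S `&` \bigcup_i H i) = (\sum_(0 <= i <oo) gamma (S `&` H
    i))%E.
    rewrite setI_bigcupr.
    have -> := @measure_bigcup _ _ _ gamma setT (fun i => S `&` H i).
    - by apply: eq_eseriesl => i; exact: in_setT.
    - by move=> i _; exact: measurableI.
    - exact/trivIset_setIl/trivIset_seqDU.
  by rewrite -UE (measureDI gamma mS mU) [X in (X + _)%E]U0 add0e.
have /choice[alpha alphaP] i : exists a : X -> R,
    [/\ measurable_fun setT (a : borel X -> R), forall x, 0 <= a x &
    forall A : set (borel X), measurable A ->
      gamma (fst @^-1` A `&` H i) = (\int[mu]_(x in A) (a x)%:E)%E].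
  have mfst := @measurable_fst_borel X Y.
  have mfstA (A : set (borel X)) : measurable A ->
    measurable (fst @^-1` A : set (borel (X * Y)%type)).
    by move=> mA; rewrite -[X in measurable X]setTI; exact: mfst.
  have [m mE] := measure_pushforward (mrestr gamma (mH i)) mfst.
  have [|a [? ? aE]] := @dominated_density _ (borel X) R mu m.
    move=> A mA; rewrite -marg// mE; apply: le_measure; rewrite ?inE.
    - by apply: measurableI => //; exact: mfstA.
    - exact: mfstA.
    - exact: subIsetl.
  by exists a; split => // A mA; rewrite -aE// mE.
exists alpha; split.
- by move=> i; have [] := alphaP i.
- by move=> i; have [] := alphaP i.
- move=> S mS; rewrite gammaE//; apply: eq_eseriesr => i _.
  have [_ _ aE] := alphaP i.
  have mB : measurable ((fun x => (x, G i x)) @^-1` S : set (borel X)).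
    by rewrite -[X in measurable X]setTI; exact: mpair.
  transitivity (\int[mu]_(x in (fun x => (x, G i x)) @^-1` S) (alpha i x)%:E)%E.
    (* On [H i] a point [(x, y)] equals [(x, G i x)], so membership in [S] depends on [x] only. *)
    rewrite -aE//; congr (gamma _); apply/seteqP; split=> -[x y] [Sz Hz];
      split=> //=.
      by rewrite (HG _ _ Hz).
    by move: Sz; rewrite /= (HG _ _ Hz).
  rewrite integral_mkcond; apply: eq_integral => x _.
  rewrite patchE indicE /= EFinM;
    have -> : (x \in (fun x => (x, G i x)) @^-1` S) = ((x, G i x) \in S).
    by apply/idP/idP; rewrite !inE.
  by case: ifPn; rewrite ?mule1 ?mule0.
- have mal i : measurable_fun setT (fun x : borel X => (alpha i x)%:E).
    by apply/measurable_EFinP; have [] := alphaP i.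
  have al0 i x : (0 <= (alpha i x)%:E)%E.
    by rewrite lee_fin; have [_ +] := alphaP i; exact.
  (* Both functions are densities of [mu] itself: the first marginals of the pieces add up to that
     of [gamma]. *)
  have : ae_eq mu setT (cst 1%E) (fun x => \sum_(0 <= i <oo) (alpha i x)%:E)%E.
    apply: integral_ae_eq => //.
    + exact: finite_measure_integrable_cst.
    + exact: ge0_emeasurable_sum.
    + move=> A _ mA; transitivity (mu A); first by rewrite integral_cst// mul1e.
      rewrite integral_nneseries//; last first.
        by move=> i; exact: measurable_funTS.
      rewrite -marg// gammaE; last by rewrite -[X in measurable X]setTI;
        exact: measurable_fst_borel.
      by apply: eq_eseriesr => i _; have [_ _ ->] := alphaP i.
  by apply: filterS => x /(_ I).
Qed.

End graph_decomposition.

(** * Constructions of measures *)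

Section probability_constructions.
Context (R : realType).

Lemma probability_pushforward d1 d2 (T1 : measurableType d1)
    (T2 : measurableType d2) (P : probability T1 R) (f : T1 -> T2) :
  measurable_fun setT f ->
  exists Q : probability T2 R, forall A, Q A = P (f @^-1` A).
Proof.
by move=> mf; exists (distribution P (mfun_Sub (mem_set mf))).
Qed.

(** Normalisation does not change a measure of mass one; [P] is the fallback value that [mnormalize]
    requires. *)
Lemma probability_of_measure d (T : measurableType d) (P : probability T R)
    (m : {measure set T -> \bar R}) : m setT = 1%E ->
  exists Q : probability T R, forall A, Q A = m A.
Proof.
move=> m1; exists (mnormalize m P) => A.
transitivity (mnormalize m P A) => //.
by rewrite /mnormalize m1 onee_eq0 /= invr1 mule1.
Qed.

(** The conditional probability given [W], in product form to avoid a division of extended reals. *)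
Lemma probability_cond d (T : measurableType d) (P : probability T R)
    (W : set T) : measurable W -> (0 < P W)%E ->
  exists Q : probability T R, forall A, measurable A ->
    (P W * Q A = P (A `&` W))%E.
Proof.
move=> mW W0.
have [m mE] : exists m : {measure set T -> \bar R}, forall A, m A = P (A `&` W).
  by exists (mrestr P mW).
exists (mnormalize m P) => A mA.
have Wfin : P W \is a fin_num by exact: fin_num_measure.
transitivity (P W * mnormalize m P A)%E => //.
have -> : mnormalize m P A = (P (A `&` W) * ((fine (P W))^-1)%:E)%E.
  have Woo : (P W == +oo%E) = false.
    by apply/negbTE; rewrite -ltey ltey_eq Wfin.
  by rewrite /mnormalize !mE setTI Woo gt_eqF//= mE.
by rewrite muleCA -{1}(fineK Wfin) -EFinM divff ?mule1// gt_eqF// fine_gt0// W0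
  ltey_eq Wfin.
Qed.

(** The product measure lives on the product sigma-algebra. It is pushed forward by the identity,
    which the countable bases make measurable for the Borel sets of the product topology. *)
Lemma probability_prod_borel (X Y : ptopologicalType) (U : nat -> set X)
    (V : nat -> set Y) (P : probability (borel X) R) (Q :
      probability (borel Y) R) :
  (forall i, measurable (U i : set (borel X))) ->
  (forall j, measurable (V j : set (borel Y))) ->
  nbhs_base U -> nbhs_base V ->
  exists S : probability (borel (X * Y)%type) R,
    forall (A : set (borel X)) (B : set (borel Y)),
      measurable A -> measurable B -> S (A `*` B) = (P A * Q B)%E.
Proof.
move=> mU mV Ub Vb.
have mid : measurable_fun setT
    ((fun z => (z.1, z.2)) : (borel X * borel Y)%type -> borel (X * Y)%type).
  by apply: (measurable_fun_borel_pair mU mV Ub Vb).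
have [S SE] := probability_pushforward (P \x Q)%E mid.
exists S => A B mA mB; rewrite SE -product_measure1E//;
  congr (product_measure1 _ _ _).
Qed.

Lemma probability_integral_ge d (T : measurableType d) (P : probability T R)
    (W : set T) (f : T -> R) (K : R) :
  measurable W -> P W = 1%E -> measurable_fun setT f -> (forall x, 0 <= f x) ->
  0 <= K -> (forall x, W x -> K <= f x) -> (K%:E <= \int[P]_x (f x)%:E)%E.
Proof.
move=> mW W1 mf f0 K0 Kf.
have WC : P (~` W) = 0%E by rewrite probability_setC// W1 subee.
rewrite -[leLHS]mule1 -(probability_setT P) -integral_cst//.
apply: ae_ge0_le_integral => //.
- by move=> x _; rewrite lee_fin.
- exact/measurable_EFinP.
- exists (~` W); split=> //; first exact: measurableC.
  by apply: subsetC => x Wx _; rewrite lee_fin Kf.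
Qed.

Lemma probability_integral_le d (T : measurableType d) (P : probability T R)
    (W : set T) (f : T -> R) (K : R) :
  measurable W -> P W = 1%E -> measurable_fun setT f -> (forall x, 0 <= f x) ->
  0 <= K -> (forall x, W x -> f x <= K) -> (\int[P]_x (f x)%:E <= K%:E)%E.
Proof.
move=> mW W1 mf f0 K0 Kf.
have WC : P (~` W) = 0%E by rewrite probability_setC// W1 subee.
rewrite -[leRHS]mule1 -(probability_setT P) -integral_cst//.
apply: ae_ge0_le_integral => //.
- by move=> x _; rewrite lee_fin.
- exact/measurable_EFinP.
- exists (~` W); split=> //; first exact: measurableC.
  by apply: subsetC => x Wx _; rewrite lee_fin Kf.
Qed.

Lemma finite_pos_lower_bound n (w : 'I_n -> R) : (forall i, 0 < w i) ->
  exists2 e, 0 < e & forall i, e <= w i.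
Proof.
(* The term [1] keeps the bound positive when there is no index. *)
move=> w0; exists (1 + \sum_i (w i)^-1)^-1.
  by rewrite invr_gt0 ltr_pwDl// sumr_ge0// => i _; rewrite invr_ge0 ltW.
move=> i; rewrite -[leRHS]invrK lef_pV2 ?posrE ?invr_gt0//; last first.
  by rewrite ltr_pwDl// sumr_ge0// => j _; rewrite invr_ge0 ltW.
rewrite (bigD1 i)//= addrCA lerDl addr_ge0// sumr_ge0// => j _.
by rewrite invr_ge0 ltW.
Qed.

(** [m] is [P - e Q], built without subtracting measures: keep [P] outside [W] and scale it on [W]
    by the non-negative factor [1 - e / P W]. *)
Lemma measure_sub_cond d (T : measurableType d) (P Q : probability T R)
    (W : set T) (e : R) : measurable W -> 0 <= e -> (e%:E <= P W)%E ->
      (0 < P W)%E ->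
  (forall A, measurable A -> (P W * Q A = P (A `&` W))%E) ->
  exists m : {measure set T -> \bar R},
    forall A, measurable A -> (m A + e%:E * Q A = P A)%E.
Proof.
move=> mW e0 eW W0 QE; have mCW := measurableC mW.
have Wfin : P W \is a fin_num by exact: fin_num_measure.
have w0 : 0 < fine (P W) by rewrite fine_gt0// W0 ltey_eq Wfin.
have k0 : 0 <= 1 - e / fine (P W).
  by rewrite subr_ge0 ler_pdivrMr// mul1r -lee_fin fineK.
have [m mE] : exists m : {measure set T -> \bar R}, forall A,
    m A = (P (A `&` ~` W) + (1 - e / fine (P W))%:E * P (A `&` W))%E.
  exists (measure_add (mrestr P mCW) (mscale (NngNum k0) (mrestr P mW))) => A.
  exact: measure_addE.
exists m => A mA; rewrite mE.
have mAW := measurableI _ _ mA mW.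
have -> : P A = (P (A `&` ~` W) + P (A `&` W))%E.
  by rewrite -setDE; exact: measureDI.
have Qfin : Q A \is a fin_num by exact: fin_num_measure.
rewrite -addeA; congr (_ + _)%E; rewrite -QE//.
rewrite -(fineK Wfin) -(fineK Qfin) -!EFinM -EFinD; congr (_%:E).
by field; rewrite gt_eqF.
Qed.

End probability_constructions.

(** * Moving mass inside a probability measure *)

Section competitor.
Context (R : realType) d (T : measurableType d).

Lemma measure_mixture n (k : R) (m : 'I_n.+1 -> {measure set T -> \bar R}) :
  0 <= k -> exists m' : {measure set T -> \bar R},
    (forall A, m' A = (k%:E * \sum_i m i A)%E) /\
    forall f : T -> \bar R, measurable_fun setT f -> (forall x, 0 <= f x)%E ->
      (\int[m']_x f x = k%:E * \sum_i \int[m i]_x f x)%E.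
Proof.
move=> k0.
exists (mscale (NngNum k0) (msum (fun j => m (inord j)) n.+1));
  split=> [A|f mf f0].
  congr (_ * _)%E; apply: (eq_bigr (fun i => m i A)) => i _.
  by rewrite inord_val.
rewrite ge0_integral_mscale//= ge0_integral_measure_sum//; congr (_ * _)%E.
by apply: eq_bigr => i _; rewrite inord_val.
Qed.

Lemma measure_addition (m1 m2 : {measure set T -> \bar R}) :
  exists m : {measure set T -> \bar R},
    (forall A, m A = (m1 A + m2 A)%E) /\
    forall f : T -> \bar R, measurable_fun setT f -> (forall x, 0 <= f x)%E ->
      (\int[m]_x f x = \int[m1]_x f x + \int[m2]_x f x)%E.
Proof.
exists (measure_add m1 m2); split=> [A|f mf f0]; first exact: measure_addE.
exact: ge0_integral_measure_add.
Qed.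

(** [P'] removes [e] times each [Q i] from [P] and adds [e] times each [S i]. The sets [W i] may
    overlap, so each [Q i] is removed from its own copy of [P], and the [n.+1] copies are
    averaged. *)
Lemma competitor_probability (P : probability T R) n (W : 'I_n.+1 -> set T)
    (Q S : 'I_n.+1 -> probability T R) :
  (forall i, measurable (W i)) -> (forall i, 0 < P (W i))%E ->
  (forall i A, measurable A -> P (W i) * Q i A = P (A `&` W i))%E ->
  exists e : R, exists P' : probability T R, [/\ 0 < e,
    forall A, measurable A ->
      (P' A + e%:E * \sum_i Q i A = P A + e%:E * \sum_i S i A)%E &
    forall f : T -> \bar R, measurable_fun setT f -> (forall x, 0 <= f x)%E ->
      (\int[P']_x f x + e%:E * \sum_i \int[Q i]_x f x =
       \int[P]_x f x + e%:E * \sum_i \int[S i]_x f x)%E].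
Proof.
move=> mW W0 QE.
have Wfin i : P (W i) \is a fin_num by exact: fin_num_measure.
have [e0 e0_gt0 e0W] : exists2 e, 0 < e & forall i, e <= fine (P (W i)).
  by apply: finite_pos_lower_bound => i; rewrite fine_gt0// W0 ltey_eq Wfin.
have /choice[m mE] i : exists m : {measure set T -> \bar R},
    forall A, measurable A -> (m A + e0%:E * Q i A = P A)%E.
  apply: (@measure_sub_cond _ _ _ P (Q i) (W i)) => //; first exact: ltW.
    by rewrite -(fineK (Wfin i)) lee_fin.
  exact: QE.
have n0 : n.+1%:R != 0 :> R by [].
have n1_ge0 : 0 <= n.+1%:R^-1 :> R by rewrite invr_ge0.
pose e : R := e0 / n.+1%:R.
have e_gt0 : 0 < e by rewrite divr_gt0.
have e_ge0 := ltW e_gt0.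
have [rho [rhoE rhoI]] := measure_mixture m n1_ge0.
have [mQ [mQE mQI]] := measure_mixture (fun i => Q i : {measure set T ->
  \bar R}) e_ge0.
have [mS [mSE mSI]] := measure_mixture (fun i => S i : {measure set T ->
  \bar R}) e_ge0.
have rhoQ A : measurable A -> (rho A + mQ A = P A)%E.
  move=> mA; rewrite rhoE mQE.
  have Qfin i : Q i A \is a fin_num by exact: fin_num_measure.
  have Pfin : P A \is a fin_num by exact: fin_num_measure.
  have -> : (\sum_i m i A = \sum_i (fine (P A) - e0 * fine (Q i A))%:E)%E.
    apply: eq_bigr => i _; rewrite EFinB EFinM (fineK Pfin) (fineK (Qfin i))
      -(mE i A mA).
    by rewrite addeK// fin_numM.
  have -> : (\sum_i Q i A = \sum_i (fine (Q i A))%:E)%E.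
    by apply: eq_bigr => i _; rewrite fineK.
  rewrite !sumEFin -!EFinM -EFinD -[RHS](fineK Pfin); congr (_%:E).
  rewrite sumrB -mulr_sumr sumr_const card_ord -[_ *+ n.+1]mulr_natl /e.
  by move: (\sum_i _) => q; field.
have [mP [mPE mPI]] := measure_addition rho mS.
have [mR [mRE mRI]] := measure_addition rho mQ.
have mPQ A : measurable A -> (mP A + mQ A = P A + mS A)%E.
  by move=> mA; rewrite mPE addeAC rhoQ.
(* All [Q i] and [S i] have mass one, so the mass added equals the mass removed. *)
have [P' P'E] : exists P' : probability T R, forall A, P' A = mP A.
  apply: (@probability_of_measure _ _ _ P); rewrite mPE.
  rewrite -(probability_setT P) -rhoQ//; congr (_ + _)%E; rewrite mQE mSE.
  congr (_ * _)%E; apply: eq_bigr => i _.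
  by transitivity (1%E : \bar R); [|apply: esym]; exact: probability_setT.
exists e, P'; split => // [A mA|f mf f0].
  by rewrite P'E -mQE -mSE mPQ.
rewrite -mQI// -mSI//.
rewrite (@eq_measure_integral _ _ _ setT mP P'); last by move=> A _ _;
  exact: P'E.
rewrite mPI// addeAC -mRI//; congr (_ + _)%E.
by apply: eq_measure_integral => A mA _; rewrite mRE rhoQ.
Qed.

End competitor.

(** * Cyclical monotonicity of the support *)

(** With [O] the open sets, this is the topological support. *)
Definition measure_support (R : realType) (T : pointedType) (O : set (set T))
    (P : probability (g_sigma_algebraType O) R) : set T :=
  [set z | forall A, O A -> A z -> (0 < P A)%E].

Section cyclical_monotonicity.
Context (R : realType) (X Y : ptopologicalType)
  (U : nat -> set X) (V : nat -> set Y).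
Hypotheses (mU : forall i, measurable (U i : set (borel X)))
  (mV : forall j, measurable (V j : set (borel Y)))
  (Ub : nbhs_base U) (Vb : nbhs_base V).
Context (c : X * Y -> R) (b : R).
Hypotheses (cc : continuous c) (cb : forall z, `|c z| <= b).
Context (mu : probability (borel X) R) (nu : probability (borel Y) R)
  (gamma : probability (borel (X * Y)%type) R).
Hypothesis gamma_opt : optimal_plan c mu nu gamma.

Let mc : measurable_fun setT (c : borel (X * Y)%type -> R).
Proof.
apply: measurable_fun_genR => A oA; apply: open_comp => // z _; exact: cc.
Qed.

(* The shift makes all bounds on the cost below nonnegative, so that only
   integrals of nonnegative functions occur. *)
Let f (z : borel (X * Y)%type) : R := c z + (b + 1).

Let mf : measurable_fun setT f. Proof. exact: measurable_funD. Qed.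

Let f_ge1 z : 1 <= f z.
Proof. by have := cb z; rewrite ler_norml /f; lra. Qed.

Let f_ge0 z : 0 <= f z. Proof. exact: le_trans ler01 (f_ge1 z). Qed.

Let f_le z : f z <= b + b + 1.
Proof. by have := cb z; rewrite ler_norml /f; lra. Qed.

Let integral_f (P : probability (borel (X * Y)%type) R) :
  (\int[P]_z (f z)%:E = transport_cost c P + (b + 1)%:E)%E.
Proof.
have ci : P.-integrable setT (EFin \o (c : borel (X * Y)%type -> R)).
  apply: measurable_bounded_integrable => //.
    by rewrite (le_lt_trans (probability_le1 _ _)) ?ltry.
  exists b; split; first exact: num_real.
  by move=> r br z _; apply: le_trans (cb z) (ltW br).
rewrite /f; under eq_integral do rewrite EFinD.
rewrite integralD//; last exact: finite_measure_integrable_cst.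
congr (_ + _)%E; rewrite -[RHS]mule1 -(probability_setT P).
exact: (@integral_cst _ _ _ P setT).
Qed.

Let integral_f_fin (P : probability (borel (X * Y)%type) R) :
  (\int[P]_z (f z)%:E)%E \is a fin_num.
Proof.
rewrite ge0_fin_numE; last by apply: integral_ge0 => z _; rewrite lee_fin.
apply: le_lt_trans (ltry (b + b + 1)).
apply: (@probability_integral_le _ _ _ P setT) => //;
  first exact: probability_setT.
exact: le_trans (f_le point).
Qed.

Let gamma_min P : coupling mu nu P ->
  (\int[gamma]_z (f z)%:E <= \int[P]_z (f z)%:E)%E.
Proof.
move=> cP; rewrite !integral_f leeD2r//; have [_ ->] := gamma_opt.
by apply: ereal_inf_lbound; exists P.
Qed.

(** Let [Q i] be [gamma] conditioned on a small box around [z i], and [S i] the product of the first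
    marginal of [Q (s i)] and the second one of [Q i]. Trading a little of the [Q i] for the [S i]
    preserves both marginals, as [s] is a permutation. So the [Q i] cost no more than the [S i], and
    continuity of [c] compares both costs with the two sums up to [e]. *)
Lemma support_cyclically_monotone n (z : 'I_n.+1 -> X * Y)
    (s s' : 'I_n.+1 -> 'I_n.+1) :
  cancel s s' -> cancel s' s ->
  (forall i, measure_support gamma (z i)) ->
  \sum_i c (z i) <= \sum_i c ((z (s i)).1, (z i).2).
Proof.
move=> sK s'K zS; apply/ler_addgt0Pr => e e0.
(* Each of the [n.+1] indices loses [dl] twice; and [dl <= 1 <= f] keeps [f - dl] non-negative. *)
pose dl : R := Num.min 1 (e / (2 * n.+1%:R)).
have dl0 : 0 < dl by rewrite /dl lt_min ltr01 divr_gt0// mulr_gt0.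
have dl1 : dl <= 1 by rewrite /dl ge_min lexx.
have /choice[A1 A1P] i : exists A : set X * set Y,
    [/\ nbhs (z i).1 A.1, nbhs (z i).2 A.2 &
        forall x y, A.1 x -> A.2 y -> c (z i) - dl <= c (x, y)].
  have : \forall w \near z i, c (z i) - dl < c w.
    have lt : c (z i) - dl < c (z i) by rewrite ltrBlDr ltrDl.
    exact: (@cvgr_gt _ _ (nbhs (z i)) _ c _ (@cc (z i)) _ lt).
  move=> [[A B] /= [zA zB] AB]; exists (A, B); split=> // x y Ax By.
  by apply/ltW; exact: (AB (x, y)).
have /choice[A2 A2P] i : exists A : set X * set Y,
    [/\ nbhs (z (s i)).1 A.1, nbhs (z i).2 A.2 &
        forall x y, A.1 x -> A.2 y ->
          c (x, y) <= c ((z (s i)).1, (z i).2) + dl].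
  have : \forall w \near ((z (s i)).1, (z i).2), c w < c ((z (s i)).1,
    (z i).2) + dl.
    set w := (_, _); have lt : c w < c w + dl by rewrite ltrDl.
    exact: (@cvgr_lt _ _ (nbhs w) _ c _ (@cc w) _ lt).
  move=> [[A B] /= [zA zB] AB]; exists (A, B); split=> // x y Ax By.
  by apply/ltW; exact: (AB (x, y)).
(* [S i] will be carried by the product of [UU (s i)] and [VV i], so [UU i] must also obey the upper
   bound chosen for the index [s' i]. *)
pose UU i := interior ((A1 i).1 `&` (A2 (s' i)).1).
pose VV i := interior ((A1 i).2 `&` (A2 i).2).
have Uz i : UU i (z i).1.
  apply: filterI; first by have [] := A1P i.
  by have [+ _ _] := A2P (s' i); rewrite s'K.
have Vz i : VV i (z i).2 by apply: filterI; [have [] := A1P i|have [] := A2P i].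
have Uo i : open (UU i) by exact: open_interior.
have Vo i : open (VV i) by exact: open_interior.
have mUU i : measurable (UU i : set (borel X)) by exact: measurable_gen.
have mVV i : measurable (VV i : set (borel Y)) by exact: measurable_gen.
pose W i : set (borel (X * Y)%type) := UU i `*` VV i.
have Wo i : open (W i : set (X * Y)).
  rewrite openE => -[x y] [/= Ux Vy]; exists (UU i, VV i) => //=.
  by split; exact: open_nbhs_nbhs.
have mW i : measurable (W i) by exact: measurable_gen.
have W0 i : (0 < gamma (W i))%E by apply: (zS i) => //; split.
have /choice[Q QE] i := probability_cond (mW i) (W0 i).
have QW i : Q i (W i) = 1%E.
  have Wfin : gamma (W i) \is a fin_num by exact: fin_num_measure.
  have Qfin : Q i (W i) \is a fin_num by exact: fin_num_measure.
  have w0 : fine (gamma (W i)) != 0 by rewrite gt_eqF// fine_gt0// W0 ltey_eq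
    Wfin.
  have := QE i _ (mW i); rewrite setIid -(fineK Wfin) -(fineK Qfin) -EFinM.
  move=> [] H; congr (_%:E); apply: (mulfI w0); rewrite mulr1; exact: H.
have mfst := @measurable_fst_borel X Y; have msnd := @measurable_snd_borel X Y.
have /choice[al alE] i := probability_pushforward (Q i) mfst.
have /choice[be beE] i := probability_pushforward (Q i) msnd.
have /choice[S SE] i := probability_prod_borel (al (s i)) (be i) mU mV Ub Vb.
have mfstA (A : set (borel X)) : measurable A ->
  measurable (fst @^-1` A : set (borel (X * Y)%type)).
  by move=> mA; rewrite -[X in measurable X]setTI; exact: mfst.
have msndB (B : set (borel Y)) : measurable B ->
  measurable (snd @^-1` B : set (borel (X * Y)%type)).
  by move=> mB; rewrite -[X in measurable X]setTI; exact: msnd.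
have alU i : al i (UU i) = 1%E.
  apply/eqP; rewrite eq_le probability_le1//= alE -(QW i).
  by apply: le_measure; rewrite ?inE//; [exact: mfstA|move=> w []].
have beV i : be i (VV i) = 1%E.
  apply/eqP; rewrite eq_le probability_le1//= beE -(QW i).
  by apply: le_measure; rewrite ?inE//; [exact: msndB|move=> w []].
have SW i : S i (UU (s i) `*` VV i) = 1%E by rewrite SE// alU beV mule1.
have S1 i (A : set (borel X)) : measurable A ->
  S i (fst @^-1` A) = Q (s i) (fst @^-1` A).
  move=> mA; rewrite -alE -[RHS]mule1 -(probability_setT (be i)) -SE//;
    congr (S i _).
  by apply/seteqP; split=> w //= [].
have S2 i (B : set (borel Y)) : measurable B ->
  S i (snd @^-1` B) = Q i (snd @^-1` B).
  move=> mB; rewrite -beE -[RHS]mul1e -(probability_setT (al (s i))) -SE//;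
    congr (S i _).
  by apply/seteqP; split=> w //= [].
have [e' [P' [e'0 P'E P'I]]] := competitor_probability S mW W0 QE.
have canc A : measurable A -> (\sum_i Q i A = \sum_i S i A)%E -> P' A = gamma A.
  move=> mA QS; have := P'E A mA; rewrite -QS.
  have fQ : (e'%:E * \sum_i Q i A)%E \is a fin_num.
    by rewrite fin_numM// sum_fin_num; apply/allP => ? /mapP[i _ ->];
      exact: fin_num_measure.
  by move=> /(congr1 (fun t => t - e'%:E * \sum_i Q i A)%E); rewrite !addeK.
have cP' : coupling mu nu P'.
  have [[g1 g2] _] := gamma_opt; split=> [A mA|B mB].
  - rewrite -g1// canc//; first exact: mfstA.
    (* The first marginals of the [S i] are those of the [Q i] in permuted order. *)
    rewrite (reindex s) /=; last by exists s' => i _.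
    by apply: eq_bigr => i _; rewrite S1.
  - by rewrite -g2// canc//; [exact: msndB|apply: eq_bigr => i _; rewrite S2].
pose I P := fine (\int[P]_w (f w)%:E)%E.
have IE (P : probability (borel (X * Y)%type) R) :
  (\int[P]_w (f w)%:E)%E = (I P)%:E.
  by rewrite /I fineK.
have II : I P' + e' * \sum_i I (Q i) = I gamma + e' * \sum_i I (S i).
  apply: EFin_inj; rewrite !EFinD !EFinM -!sumEFin.
  under eq_bigr do rewrite -IE; under [in RHS]eq_bigr do rewrite -IE.
  by rewrite -!IE P'I//; exact/measurable_EFinP.
have Imin : I gamma <= I P' by rewrite -lee_fin -!IE; exact: gamma_min.
have QS : \sum_i I (Q i) <= \sum_i I (S i).
  by rewrite -(ler_pM2l e'0); lra.
have IQ i : f (z i) - dl <= I (Q i).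
  rewrite -lee_fin -IE; apply: (@probability_integral_ge _ _ _ (Q i) (W i)) =>
    //.
    by rewrite subr_ge0 (le_trans dl1).
  move=> [x y] [/= /interior_subset[Ax _] /interior_subset[By _]].
  by have [_ _ /(_ x y Ax By)] := A1P i; rewrite /f; lra.
have IS i : I (S i) <= f ((z (s i)).1, (z i).2) + dl.
  rewrite -lee_fin -IE; apply: (@probability_integral_le _ _ _ (S i) (UU (s i)
    `*` VV i)) => //.
  - apply: measurable_gen; rewrite openE => -[x y] [/= Ux Vy].
    exists (UU (s i), VV i) => //=.
    by split; exact: open_nbhs_nbhs.
  - by rewrite addr_ge0// ltW.
  move=> [x y] [/= /interior_subset[_ Ax] /interior_subset[_ By]].
  rewrite sK in Ax; by have [_ _ /(_ x y Ax By)] := A2P i; rewrite /f; lra.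
have : \sum_i (f (z i) - dl) <= \sum_i (f ((z (s i)).1, (z i).2) + dl).
  by apply: le_trans (ler_sum _ _) (le_trans QS (ler_sum _ _)) => i _.
have sumE (g : 'I_n.+1 -> R) k : \sum_i (g i + k) = \sum_i g i + n.+1%:R * k.
  by rewrite big_split /= sumr_const card_ord mulr_natl.
rewrite /f; under eq_bigr do rewrite -addrA.
under [leRHS]eq_bigr do rewrite -addrA.
rewrite !sumE => H.
have ndl : n.+1%:R * dl <= e / 2.
  have : dl <= e / (2 * n.+1%:R) by rewrite /dl ge_min lexx orbT.
  by rewrite !ler_pdivlMr ?mulr_gt0// [2 * _]mulrC mulrA [dl * _]mulrC.
move: H ndl; rewrite !mulrDr mulrN.
by move: (n.+1%:R * dl) (n.+1%:R * b) (n.+1%:R * 1) => u v w; lra.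
Qed.

End cyclical_monotonicity.

(** * The potential of a cyclically monotone set *)

(** A negative derivative along [v] would make [h] smaller than [h u] at [t *: v + u] for small
    [t > 0]. *)
Lemma derive_at_min_ge0 (R : realType) (V : normedModType R) (h : V ->
  R) (u v : V) :
  differentiable h u -> (\forall w \near u, h u <= h w) -> 0 <= 'd h u v.
Proof.
move=> dh hmin; rewrite leNgt; apply/negP => L0.
have dq : (fun t : R => t^-1 *: ((h \o shift u) (t *: v) - h u)) @ 0^' --> 'd h
  u v.
  by rewrite -deriveE//; exact: (@diff_derivable _ _ _ _ _ v dh).
have q0 : \forall t \near (0 : R), t != 0 ->
    t^-1 *: ((h \o shift u) (t *: v) - h u) < 0.
  exact: (cvgr_lt _ dq _ L0).
have hm : \forall t \near (0 : R), h u <= h (t *: v + u).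
  have : (fun t : R => t *: v + u) @ (0 : R) --> u.
    rewrite -[X in _ --> X]add0r -(scale0r v).
    by apply: cvgD; [apply: cvgZr_tmp; exact: cvg_id|exact: cvg_cst].
  by move=> /(_ _ hmin).
have [t [t0 [qt ht]]] : exists t : R, 0 < t /\
    (t^-1 *: ((h \o shift u) (t *: v) - h u) < 0 /\ h u <= h (t *: v + u)).
  have [e /= e0 He] := @filterI _ (nbhs (0 : R)) _ _ _ q0 hm.
  have [|q ht] := He (e / 2).
    by rewrite /= sub0r normrN gtr0_norm ?divr_gt0// gtr_pMr// invf_lt1 ?ltr1n.
  exists (e / 2); rewrite divr_gt0//; split=> //; split=> //; apply: q.
  by rewrite gt_eqF// divr_gt0.
move: qt; apply/negP; rewrite -leNgt; apply: mulr_ge0;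
  first by rewrite invr_ge0 ltW.
by rewrite subr_ge0.
Qed.

Lemma diff_at_min (R : realType) (V : normedModType R) (h : V -> R) (u v : V) :
  differentiable h u -> (\forall w \near u, h u <= h w) -> 'd h u v = 0.
Proof.
move=> dh hmin; apply/eqP; rewrite eq_le (derive_at_min_ge0 v dh hmin) andbT.
by have := derive_at_min_ge0 (- v) dh hmin; rewrite linearN oppr_ge0.
Qed.

Section potential.
Context (R : realType) (X Y : ptopologicalType) (c : X * Y ->
  R) (S : set (X * Y)).
Context (z0 : X * Y).
Hypothesis Sz0 : S z0.
Hypothesis S_cm : forall n (z : 'I_n.+1 -> X * Y) (s s' : 'I_n.+1 -> 'I_n.+1),
  cancel s s' -> cancel s' s -> (forall i, S (z i)) ->
  \sum_i c (z i) <= \sum_i c ((z (s i)).1, (z i).2).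

(* [reach z r]: some chain in [S] from [z0] to [z] has cost increment [r]. *)
Inductive reach : X * Y -> R -> Prop :=
| reach0 : reach z0 0
| reachS z r w : reach z r -> S w -> reach w (r + c (w.1, z.2) - c z).

Lemma reach_chain z r : reach z r -> exists n (w : nat -> X * Y),
  [/\ w 0%N = z0, w n = z, forall i, S (w i) &
      r = \sum_(i < n) (c ((w i.+1).1, (w i).2) - c (w i))].
Proof.
elim=> [|{}z {}r z' _ [n [w [w0 wn wS rE]]] Sz'].
  by exists 0%N, (fun=> z0); split=> //; rewrite big_ord0.
(* Past the last index the sequence is constant, which keeps it in [S]. *)
exists n.+1, (fun i => if (i <= n)%N then w i else z'); split=> //.
- by rewrite ltnn.
- by move=> i; case: ifP.
- rewrite big_ord_recr /= ltnn leqnn wn rE -addrA; congr (_ + _).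
  by apply: eq_bigr => i _; rewrite (ltn_ord i) (ltnW (ltn_ord i)).
Qed.

(** Returning to [z0] closes the chain into a cycle, to which cyclical monotonicity applies with the
    cyclic shift. *)
Lemma reach_ge0 z r : reach z r -> 0 <= r - c z + c (z0.1, z.2).
Proof.
move=> /reach_chain[n [w [w0 wn wS ->]]].
have := @S_cm n (fun i => w i) _ _ (@ordSK n.+1) (@ord_predK n.+1) (fun i =>
  wS i).
(* [modnn] sends the successor of the last index to [0], hence to [z0]. *)
rewrite !big_ord_recr /= modnn w0 wn.
under [X in _ <= X + _]eq_bigr => i _ do rewrite modn_small ?ltnS//.
by rewrite sumrB; lra.
Qed.

(** Rockafellar's potential is the infimum of [r - c z + c (x, z.2)] over the chains; grouping them
    by [z.2] puts it in [c]-concave form. If no chain ends over [y], [reach_psi y] is [-oo] and [y]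
    does not affect the infimum. *)
Definition reach_psi (y : Y) : \bar R :=
  ereal_sup [set t | exists z r, [/\ reach z r, z.2 = y & t = (c z - r)%:E]].

Definition reach_phi (x : X) : \bar R :=
  ereal_inf [set ((c (x, y))%:E - reach_psi y)%E | y in [set: Y]].

Lemma reach_phi_le x z r : reach z r ->
  (reach_phi x <= (r - c z + c (x, z.2))%:E)%E.
Proof.
move=> zr; apply: (@le_trans _ _ ((c (x, z.2))%:E - reach_psi z.2)%E).
  by apply: ereal_inf_lbound; exists z.2.
rewrite (_ : r - c z + c (x, z.2) = c (x, z.2) - (c z - r)); last by ring.
rewrite EFinB leeD2l// leeN2; apply: ereal_sup_ubound.
by exists z, r.
Qed.

Lemma reach_phi_ge x l :
  (forall z r, reach z r -> l <= r - c z + c (x, z.2)) ->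
    (l%:E <= reach_phi x)%E.
Proof.
move=> H; apply: le_ereal_inf_tmp => _ [y _ <-].
have : (reach_psi y <= (c (x, y) - l)%:E)%E.
  apply: ge_ereal_sup => _ [z [r [zr <- ->]]]; rewrite lee_fin.
  by have := H _ _ zr; lra.
rewrite -leeN2 => /(leeD2l (c (x, y))%:E); apply: le_trans.
by rewrite -EFinN -EFinD lee_fin; lra.
Qed.

Lemma reach_phi_lty x : (reach_phi x < +oo)%E.
Proof. exact: le_lt_trans (reach_phi_le x reach0) (ltry _). Qed.

Lemma reach_phi_z0 : reach_phi z0.1 \is a fin_num.
Proof.
rewrite fin_numElt reach_phi_lty andbT.
by apply: lt_le_trans (reach_phi_ge (l := 0) _);
  [exact: ltNyr|exact: reach_ge0].
Qed.

(** Prolong every chain by [(x, y)] before evaluating at [x']. This is the minimality of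
    [c (_, y) - reach_phi] at [x]. *)
Lemma reach_phi_contact x y x' : S (x, y) -> reach_phi x' \is a fin_num ->
  (reach_phi x' <= reach_phi x + (c (x', y) - c (x, y))%:E)%E.
Proof.
move=> Sxy fx'; rewrite -leeBlDr// -(fineK fx') -EFinB.
apply: reach_phi_ge => z r zr.
have := reach_phi_le x' (reachS zr Sxy); rewrite -(fineK fx') lee_fin /=; lra.
Qed.

(** Contact with [x' = z0.1], where the potential is finite, excludes [-oo] at [x]. *)
Lemma reach_phi_fin x y : S (x, y) -> reach_phi x \is a fin_num.
Proof.
move=> Sxy; have := reach_phi_contact Sxy reach_phi_z0.
rewrite fin_numElt reach_phi_lty andbT -(fineK reach_phi_z0).
by case: (reach_phi x) => [r||] //=; rewrite ?ltNyr.
Qed.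

Lemma reach_phi_c_concave : c_concave c reach_phi.
Proof.
split; [|exists z0.1|by exists reach_psi].
- by move=> x xoo; have := reach_phi_lty x; rewrite xoo.
- by move=> xoo; have := reach_phi_z0; rewrite xoo.
Qed.

(** Read in the chart at [x], [c (_, y)] minus the potential has a local minimum, so its
    differential vanishes. *)
Lemma mdiff_contact n (M : riemannianManifold R n X) x y :
  S (x, y) -> emdifferentiable M reach_phi x ->
  mdifferentiable M (fun x' => c (x', y)) x ->
  mdiff M (fun x' => c (x', y)) x = mdiff M (fine \o reach_phi) x.
Proof.
move=> Sxy [fnear dphi] dc; have fx := reach_phi_fin Sxy.
apply/funext => v; apply/eqP; rewrite -subr_eq0; apply/eqP.
rewrite /mdiff /mdifferentiable in dphi dc *.
set f1 := local_repr M (fun x' => c (x', y)) x in dc *.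
set f2 := local_repr M (fine \o reach_phi) x in dphi *.
set u := local_coord M x x in dphi dc *.
have <- : 'd (f1 - f2) u v = 'd f1 u v - 'd f2 u v by rewrite diffB.
apply: diff_at_min; first exact: differentiableB.
have pu : rm_param M (rm_chart_at M x) u = x.
  by apply: rm_coordK; exact: rm_dom_chart_at.
have pc : {for u, continuous (rm_param M (rm_chart_at M x))}.
  apply: rm_param_continuous; exists x => //; exact: rm_dom_chart_at.
(* The contact inequality needs a finite potential at the nearby point; continuity of the chart
   inverse transfers finiteness near [x] to the chart. *)
have : \forall w \near u, reach_phi (rm_param M (rm_chart_at M x) w) \is a
  fin_num.
  by have := pc [set x' | reach_phi x' \is a fin_num]; rewrite pu; exact.
apply: filterS => w fw; rewrite /f1 /f2 /local_repr /= !fctE /= pu.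
have := reach_phi_contact Sxy fw;
  rewrite -(fineK fw) -(fineK fx) -EFinD lee_fin; lra.
Qed.

End potential.

(** * The support of a plan *)

Section support.
Context (R : realType) (X Y : ptopologicalType)
  (U : nat -> set X) (V : nat -> set Y).
Hypotheses (mU : forall i, measurable (U i : set (borel X)))
  (mV : forall j, measurable (V j : set (borel Y)))
  (Ub : nbhs_base U) (Vb : nbhs_base V).
Context (gamma : probability (borel (X * Y)%type) R).

Lemma closed_measure_support : closed (measure_support gamma).
Proof.
have nbhs_open (A : set (X * Y)) : (forall z, A z -> nbhs z A) -> open A.
  by rewrite openE.
rewrite -[measure_support _]setCK; apply/open_closedC/nbhs_open => z.
move=> /existsNP[W /not_implyP[oW /not_implyP[Wz W0]]].
apply: (@filterS _ (nbhs z) _ W) => [w Ww /(_ W oW Ww) //|].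
exact: open_nbhs_nbhs.
Qed.

(** A point off the support has a null open neighbourhood, hence lies in a null box; there are
    countably many of these. *)
Lemma measure_supportC : gamma.-negligible (~` measure_support gamma).
Proof.
pose N i j : set (borel (X * Y)%type) :=
  if pselect (gamma (U i `*` V j) = 0%E) then U i `*` V j else set0.
have mUV i j : measurable (U i `*` V j : set (borel (X * Y)%type)).
  have -> : U i `*` V j = fst @^-1` U i `&` snd @^-1` V j by [].
  apply: measurableI; rewrite -[X in measurable X]setTI.
    exact: measurable_fst_borel.
  exact: measurable_snd_borel.
have N0 : gamma.-negligible (\bigcup_i \bigcup_j N i j).
  apply: negligible_bigcup => i; apply: negligible_bigcup => j.
  by rewrite /N; case: pselect => /= [H|_];
    [exact/negligibleP|exact: negligible_set0].
apply: negligibleS N0 => -[x y] /existsNP[W /not_implyP[oW /not_implyP[Wz W0]]].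
have : nbhs (x, y) W by exact: open_nbhs_nbhs.
move=> [[A B] /= [/Ub[i Ui UA] /Vb[j Vj VB]] ABO].
exists i => //; exists j => //; rewrite /N; case: pselect => /= [_|[]].
  by split; exact: nbhs_singleton.
apply/eqP; rewrite -measure_le0; apply: (@le_trans _ _ (gamma W)).
  apply: le_measure; rewrite ?inE//; first exact: measurable_gen.
  by move=> [x' y'] [/UA ? /VB ?]; exact: ABO.
by move/negP : W0; rewrite -leNgt.
Qed.

Lemma measure_support_neq0 : measure_support gamma !=set0.
Proof.
apply/set0P/negP => /eqP S0; have := measure_supportC.
rewrite S0 setC0 => /negligibleP => /(_ measurableT)/eqP.
by rewrite [X in X == _](probability_setT gamma) onee_eq0.
Qed.

End support.

(** As [Y] is Hausdorff, [(x, y)] is off the graph exactly when some [F j] contains [g x] and misses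
    [y]. *)
Lemma measurable_graph (X Y : ptopologicalType) (F : nat -> set Y) (g : X ->
  Y) :
  hausdorff_space Y -> (forall j, measurable (F j : set (borel Y))) ->
    nbhs_base F ->
  measurable_fun setT (g : borel X -> borel Y) ->
  measurable ([set z | g z.1 = z.2] : set (borel (X * Y)%type)).
Proof.
move=> hY mF Fb mg.
have -> : [set z : X * Y | g z.1 = z.2] =
    ~` (\bigcup_j (fst @^-1` (g @^-1` F j) `&` snd @^-1` ~` F j)).
  apply/seteqP; split=> [[x y] /= <- [j _ []]//|[x y] /= H].
  apply: contrapT => gxy; apply: H.
  have [|j gj jy] := Fb (g x) (~` [set y]).
    apply: open_nbhs_nbhs; split=> //; apply: closed_openC.
    by apply: accessible_closed_set1; exact: hausdorff_accessible.
  by exists j => //; split=> /=; [exact: nbhs_singleton|move=> /jy; apply].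
apply: measurableC; apply: bigcup_measurable => j _; apply: measurableI.
  rewrite -[X in measurable X]setTI; apply: measurable_fst_borel => //.
  by rewrite -[X in measurable X]setTI; exact: mg.
rewrite -[X in measurable X]setTI; apply: measurable_snd_borel => //.
exact: measurableC.
Qed.

Theorem theorem1p4 (R : realType) (n : nat) (X Y : ptopologicalType)
    (M : riemannianManifold R n X)
    (X_complete : complete_dist (riemannian_dist M))
    (X_separable : separable_space X)
    (Y_polish : polish_space R Y)
    (mu : probability (borel X) R) (nu : probability (borel Y) R)
    (c : X * Y -> R)
    (c_continuous : continuous c)
    (c_bounded : exists B : R, forall z, `|c z| <= B)
    (c_twist : generalized_twist M c)
    (mu_nonatomic : nonatomic mu)
    (c_concave_ae : forall phi : X -> \bar R, c_concave c phi ->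
      {ae mu, forall x, phi x \is a fin_num -> emdifferentiable M phi x})
    (gamma : probability (borel (X * Y)%type) R)
    (gamma_optimal : optimal_plan c mu nu gamma) :
  exists (k : option nat) (alpha : nat -> X -> R) (G : nat -> X -> Y),
    [/\ index_lt 0 k,
        forall i, index_lt i k ->
          [/\ measurable_fun setT (alpha i : borel X -> R),
              forall x, 0 <= alpha i x &
              measurable_fun setT (G i : borel X -> borel Y)],
        forall S : set (borel (X * Y)%type), measurable S ->
          gamma S = (\sum_(0 <= i <oo | index_lt i k)
            \int[mu]_x (alpha i x * \1_S (x, G i x))%:E)%E &
        {ae mu, forall x,
          (\sum_(0 <= i <oo | index_lt i k) (alpha i x)%:E)%E = 1%E}].
Proof.
have [Y_sep [d [dm dtop _]]] := Y_polish.
have hY : hausdorff_space Y := metric_hausdorff dm dtop.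
have [F Fcl Fb] := separable_metric_base dm dtop Y_sep.
have mF j : measurable (F j : set (borel Y)).
  by apply: measurable_genC; exact: closed_openC.
have [U Uo Ub] := second_countable_base (rm_second_countable M).
have mU j : measurable (U j : set (borel X)) by exact: measurable_gen.
have [b cb] := c_bounded.
pose S : set (X * Y) := measure_support gamma.
have Scl : closed S by exact: closed_measure_support.
have [z0 Sz0] : S !=set0 := measure_support_neq0 mU mF Ub Fb gamma.
have S_cm :=
  support_cyclically_monotone mU mF Ub Fb c_continuous cb gamma_optimal.
pose phi := reach_phi c S z0.
have [N [mN N0 NP]] := c_concave_ae phi (reach_phi_c_concave Sz0 S_cm).
have S_fin x : ~ N x -> finite_set [set y | S (x, y)].
  move=> Nx; have [[y0 Sxy0]|nS] := pselect (exists y, S (x, y)); last first.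
    rewrite (_ : [set y | _] = set0)//; apply/seteqP; split=> // y Sxy.
    by case: nS; exists y.
  (* The potential is finite wherever the section is nonempty, so it is differentiable there outside
     [N]. *)
  have dphi : emdifferentiable M phi x.
    apply: contrapT => nd; apply: Nx; apply: NP => /= H.
    by apply: nd; apply: H; exact: (reach_phi_fin Sz0 S_cm Sxy0).
  have [dc twist] := c_twist.
  apply: sub_finite_set (twist x y0) => y Sxy /=.
  rewrite (mdiff_contact Sz0 S_cm Sxy dphi (dc y x)).
  by rewrite (mdiff_contact Sz0 S_cm Sxy0 dphi (dc y0 x)).
have [C Ccc nuC] := polish_tight nu Y_polish.
have [G mG GP] := measurable_graph_cover hY Fcl Fb Scl (fun m => (Ccc m).1).
have [[marg1 marg2] _] := gamma_optimal.
have mgraph i : measurable ([set z | G i z.1 = z.2] : set (borel (X * Y)%type)).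
  exact: (measurable_graph hY mF Fb).
have mpair i : measurable_fun setT
    ((fun x => (x, G i x)) : borel X -> borel (X * Y)%type).
  by apply: (measurable_fun_borel_pair mU mF Ub Fb) => //; exact: measurable_id.
have mC : measurable (~` \bigcup_m C m : set (borel Y)).
  apply: measurableC; apply: bigcup_measurable => m _.
  by apply: measurable_genC; apply: closed_openC; have [] := Ccc m.
(* For [gamma]-almost every [(x, y)], the point is in [S], [y] is in some [C m] and [x] is outside
   [N], the last two by the marginals; the graphs cover all such points. *)
have graphs0 : gamma (\bigcap_i [set z | G i z.1 <> z.2]) = 0%E.
  apply/negligibleP.
    by apply: bigcap_measurable => // i _; exact: (measurableC (mgraph i)).
  have SC : gamma.-negligible (~` S) := measure_supportC mU mF Ub Fb gamma.
  have CC : gamma.-negligible (snd @^-1` (~` \bigcup_m C m)).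
    apply/negligibleP; last exact: etrans (marg2 _ mC) nuC.
    by rewrite -[X in measurable X]setTI; exact: measurable_snd_borel.
  have NC : gamma.-negligible (fst @^-1` N).
    apply/negligibleP; last exact: etrans (marg1 _ mN) N0.
    by rewrite -[X in measurable X]setTI; exact: measurable_fst_borel.
  apply: negligibleS (negligibleU (negligibleU SC CC) NC) => -[x y] /= zG.
  have [Nx|Nx] := pselect (N x); first by right.
  have [Sxy|?] := pselect (S (x, y)); last by left; left.
  left; right => /= Cy.
  by have [i Gi] := GP x y Sxy Cy (S_fin x Nx); exact: (zG i I).
have [alpha [malpha alpha0 alphaE alpha1]] :=
  graph_decomposition marg1 mpair mgraph graphs0.
(* [None] stands for an infinite [k], for which [index_lt] accepts every index. *)
by exists None, alpha, G; split.
Qed.
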